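(* Let $\mathbf{M}$ be an $n\times n$ matrix (real, non-negative, with no zero rows and no zero columns) with exactly $d\ge1$ positive diagonals. Then $\mathrm{CI}(\mathbf{M})\ge 1/d$.
   Context: For an $n\times n$ matrix $A=(a_{ij})$ and a permutation $\sigma\in S_n$, the diagonal of $A$ determined by $\sigma$ is $\{a_{1,\sigma(1)},\dots,a_{n,\sigma(n)}\}$; it is positive if all $a_{i,\sigma(i)}>0$. The number of positive diagonals is the number of $\sigma\in S_n$ that determine a positive diagonal. Sinkhorn (SK) iteration of $\mathbf{M}$ generates $\mathbf{L}^1,\mathbf{T}^1,\mathbf{L}^2,\mathbf{T}^2,\dots$, where $\mathbf{L}^1$ is the row normalization of $\mathbf{M}$ (each row divided by its sum), $\mathbf{T}^k$ is the column normalization of $\mathbf{L}^k$ (each column divided by its sum), and $\mathbf{L}^{k+1}$ is the row normalization of $\mathbf{T}^k$. With limits $\mathbf{L}=(l_{ij})$ of $\mathbf{L}^k$ and $\mathbf{T}=(t_{ij})$ of $\mathbf{T}^k$, the cooperative index is $\mathrm{CI}(\mathbf{M})=\frac1n\sum_{i,j}l_{ij}t_{ij}$. By Sinkhorn and Knopp, when $\mathbf{M}$ is square with at least one positive diagonal, $\mathbf{L}=\mathbf{T}=\mathbf{M}^*$ is a doubly stochastic matrix, so $\mathrm{CI}(\mathbf{M})=\frac1n\sum_{i,j}(m^*_{ij})^2$. *)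

(* Defs.v *)
From mathcomp Require Import all_boot all_order all_algebra all_fingroup.
From mathcomp Require Import all_classical all_reals all_analysis.
Import Order.TTheory GRing.Theory Num.Theory.
Import numFieldNormedType.Exports.

Set Implicit Arguments.
Unset Strict Implicit.
Unset Printing Implicit Defensive.

Local Open Scope classical_set_scope.
Local Open Scope ring_scope.

Section Sinkhorn.
Variables (R : realType) (n : nat).
Implicit Type M : 'M[R]_n.

Definition positive_diagonal M (s : 'S_n) : bool :=
  [forall i, 0 < M i (s i)].

Definition positive_diagonals M : {set 'S_n} :=
  [set s : 'S_n | positive_diagonal M s]%SET.

(* Division by a zero sum yields 0; this never happens in the iteration
   started from a nonnegative matrix without zero rows or columns. *)
Definition row_normalize M : 'M[R]_n :=
  \matrix_(i, j) (M i j / \sum_(l < n) M i l).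

Definition col_normalize M : 'M[R]_n :=
  \matrix_(i, j) (M i j / \sum_(l < n) M l j).

(* Indices are shifted by one: SK_L M k is L^(k+1), SK_T M k is T^(k+1). *)
Fixpoint SK_L M (k : nat) : 'M[R]_n :=
  if k is k'.+1 then row_normalize (col_normalize (SK_L M k'))
  else row_normalize M.

Definition SK_T M (k : nat) : 'M[R]_n := col_normalize (SK_L M k).

(* The value of lim is unspecified for a divergent sequence; convergence holds
   as soon as M has a positive diagonal (Sinkhorn and Knopp). *)
Definition SK_limL M : 'M[R]_n := lim (SK_L M k @[k --> \oo]).

Definition SK_limT M : 'M[R]_n := lim (SK_T M k @[k --> \oo]).

Definition CI M : R :=
  n%:R^-1 * \sum_(i < n) \sum_(j < n) SK_limL M i j * SK_limT M i j.

End Sinkhorn.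

(* Main.v *)
(* Convergence of the iteration (following Csiszar's treatment of alternating
   projections): if B is doubly stochastic and supported in M, each
   normalization of an iterate X increases sum_ij b_ij ln x_ij by
   - sum ln (line sums), which is nonnegative because the line sums average 1.
   Applied to the permutation matrix of a positive diagonal this forces the
   column sums of L^k to 1, so a cluster point B of L^k is doubly stochastic and
   supported in M. Applied to that B it shows that KL(B || L^k) decreases, and
   its limit is 0 along a subsequence, whence L^k and T^k both tend to B.

   Lower bound: by Birkhoff B = sum_s lam_s P_s, where lam_s > 0 only on the d
   positive diagonals of M. Since b_(i, s i) >= lam_s, the sum of the b_ij ^ 2
   is at least n sum_s lam_s ^ 2 >= n / d by Cauchy-Schwarz. *)

Require Import Defs.
From mathcomp Require Import all_boot all_order all_algebra all_fingroup.
From mathcomp Require Import all_classical all_reals all_analysis.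
From mathcomp Require Import ring lra.
Import Order.TTheory GRing.Theory Num.Theory.
Import numFieldNormedType.Exports.
Local Open Scope ring_scope.

(** * Hall's marriage theorem *)

Definition neighbours {T U : finType} (e : T -> U -> bool) (S : {set T}) :
  {set U} := [set y | [exists x in S, e x y]]%SET.

Lemma neighboursP {T U : finType} (e : T -> U -> bool) (S : {set T}) y :
  reflect (exists2 x, x \in S & e x y) (y \in neighbours e S).
Proof. by rewrite inE; apply: exists_inP. Qed.

(* Induction on #|A|: either a proper nonempty S with #|S| = #|N(S)| is matched
   separately from A :\: S, or any edge can be removed with both its ends. *)
Lemma hall {T U : finType} (e : T -> U -> bool) (A : {set T}) :
  (forall S : {set T}, S \subset A -> (#|S| <= #|neighbours e S|)%N) ->
  exists f : T -> option U,
    {in A, forall x, exists2 y, f x = Some y & e x y} /\ {in A &, injective f}.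
Proof.
have [k] := ubnP #|A|; elim: k e A => // k IH e A /ltnSE Ak H.
have [->|/set0Pn[a aA]] := eqVneq A finset.set0.
  by exists (fun=> None); split=> x; rewrite inE.
have [/existsP[S /and4P[SA S0 SnA /eqP NS]]|noS] :=
  boolP [exists S : {set T}, [&& S \subset A, S != finset.set0, S != A
           & #|neighbours e S| == #|S|]].
- have SpA : S \proper A by rewrite finset.properEneq SnA.
  have Sk : (#|S| < k)%N by apply: leq_trans (proper_card SpA) Ak.
  have [|f [fe fi]] := IH e S Sk.
    by move=> W WS; apply: H; apply: fintype.subset_trans WS SA.
  (* Edges into the neighbourhood of the tight set [S] are dropped, so that the matching [g] of the
     rest avoids every value taken by [f] on [S]. *)
  pose e' x y := e x y && (y \notin neighbours e S).
  have DA : (#|A :\: S| < k)%N.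
    apply: leq_trans Ak; rewrite cardsD (finset.setIidPr SA).
    by rewrite ltn_subrL card_gt0 S0 card_gt0; apply/set0Pn; exists a.
  have [|g [ge gi]] := IH e' (A :\: S)%SET DA.
    (* Hall's condition for [W :|: S] splits as |W| + |S| <= |N'(W)| + |N(S)|, and tightness of [S]
       cancels the second terms. *)
    move=> W WA; have := H (W :|: S)%SET; rewrite finset.subUset SA andbT.
    move=> /(_ (fintype.subset_trans WA (finset.subsetDl _ _))).
    have -> : neighbours e (W :|: S)%SET =
              (neighbours e' W :|: neighbours e S)%SET.
      apply/setP => y; rewrite finset.in_setU; apply/neighboursP/orP.
      - move=> [x]; rewrite finset.in_setU => /orP[xW|xS] exy.
        + have [yS|yS] := boolP (y \in neighbours e S); [by right|left].
          by apply/neighboursP; exists x => //; rewrite /e' exy.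
        + by right; apply/neighboursP; exists x.
      - case=> /neighboursP[x xS].
        + by move=> /andP[exy _]; exists x => //; rewrite finset.in_setU xS.
        + by exists x => //; rewrite finset.in_setU xS orbT.
    have -> : (#|W :|: S| = #|W| + #|S|)%N.
      rewrite cardsU; suff -> : (W :&: S = finset.set0)%SET by rewrite cards0 subn0.
      apply/setP => x; rewrite !inE; apply/negP => /andP[xW xS].
      by move: (fintype.subsetP WA x xW); rewrite inE xS.
    by rewrite cardsU NS => /leq_trans/(_ (leq_subr _ _)); rewrite leq_add2r.
  exists (fun x => if x \in S then f x else g x); split=> [x xA|x x' xA x'A].
    case: ifP => xS; first exact: fe.
    have [|y gy /andP[exy _]] := ge x; first by rewrite inE xS.
    by exists y.
  have cross u v : u \in S -> v \in A -> v \notin S -> f u = g v -> False.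
    move=> uS vA vS; have [y -> euy] := fe u uS.
    have [|z -> /andP[_ /neighboursP ezS] [yz]] := ge v; first by rewrite inE vS.
    by apply: ezS; exists u; rewrite -?yz.
  case: ifP => xS; case: ifP => x'S //.
  - exact: fi.
  - by move=> h; case: (cross x x' xS x'A _ h); rewrite x'S.
  - by move=> h; case: (cross x' x x'S xA _ (esym h)); rewrite xS.
  - by apply: gi; rewrite inE ?xS ?x'S.
have [b eab] : exists b, e a b.
  have := H [set a]%SET; rewrite finset.sub1set cards1 => /(_ aA).
  by rewrite card_gt0 => /set0Pn[b /neighboursP[x /set1P-> ?]]; exists b.
pose e' x y := e x y && (y != b).
have DA : (#|A :\ a| < k)%N.
  by apply: leq_trans Ak; rewrite (cardsD1 a A) aA.
have [|g [ge gi]] := IH e' (A :\ a)%SET DA.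
  move=> W WA; have [->|W0] := eqVneq W finset.set0; first by rewrite cards0.
  have WsA : W \subset A by apply: fintype.subset_trans WA (finset.subsetDl _ _).
  (* [W] omits [a], so it is a proper subset of [A] and cannot be tight in this case; the strict
     inequality pays for the loss of [b]. *)
  have lt : (#|W| < #|neighbours e W|)%N.
    rewrite ltn_neqAle H // andbT eq_sym; apply: contraNN noS => NW.
    apply/existsP; exists W; rewrite WsA W0 NW andbT /=.
    by apply: contraTneq WA => ->; apply/fintype.subsetPn; exists a; rewrite // !inE eqxx.
  have sub : (neighbours e W :\ b)%SET \subset neighbours e' W.
    apply/fintype.subsetP => y; rewrite finset.in_setD1 => /andP[yb /neighboursP[x xW exy]].
    by apply/neighboursP; exists x; rewrite // /e' exy.
  apply: leq_trans (subset_leq_card sub).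
  by rewrite -ltnS (leq_trans lt) // (cardsD1 b) -add1n leq_add2r leq_b1.
exists (fun x => if x == a then Some b else g x); split=> [x xA|x x' xA x'A].
  case: eqP => [->|/eqP xa]; first by exists b.
  by have [|y gy /andP[exy _]] := ge x; [rewrite !inE xa|exists y].
have cross u : u \in A -> u != a -> Some b = g u -> False.
  move=> uA ua; have [|y -> /andP[_ /eqP yb] [?]] := ge u; first by rewrite !inE ua.
  exact: yb.
case: eqP => [->|/eqP xa]; case: eqP => [->|/eqP x'a] //.
- by move/(cross _ x'A x'a).
- by move/esym/(cross _ xA xa).
- by apply: gi; rewrite !inE ?xa ?x'a.
Qed.

(** * Birkhoff's decomposition *)

(** Double counting gives Hall's condition for the graph of positive entries: the rows of [S] have
    mass s |S|, all of it inside the columns of N(S), whose mass is s |N(S)|. *)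
Lemma const_sums_positive_diagonal {R : realType} {n : nat} (B : 'M[R]_n)
    (s : R) :
  0 < s -> (forall i j, 0 <= B i j) ->
  (forall i, \sum_j B i j = s) -> (forall j, \sum_i B i j = s) ->
  exists t : 'S_n, positive_diagonal B t.
Proof.
move=> s0 B0 Br Bc.
pose e (i j : 'I_n) := 0 < B i j.
have [|f [fe fi]] := hall e [set: 'I_n]%SET.
  move=> S _; rewrite -(ler_nat R) -(ler_pM2r s0).
  rewrite !mulr_natl -!sumr_const.
  have -> : \sum_(i in S) s = \sum_(i in S) \sum_(j in neighbours e S) B i j.
    apply: eq_bigr => i iS; rewrite -(Br i) [LHS](bigID (mem (neighbours e S))) /=.
    rewrite [X in _ + X]big1 ?addr0 // => j jN; apply/eqP.
    rewrite eq_le B0 andbT leNgt; apply: contra jN => Bij.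
    by apply/neighboursP; exists i.
  rewrite exchange_big; apply: ler_sum => j _; rewrite -(Bc j).
  rewrite [leRHS](bigID (mem S)) /= lerDl; exact: sumr_ge0.
pose g i := odflt i (f i).
have fg i : f i = Some (g i).
  by have [|y fy _] := fe i; rewrite ?inE // /g fy.
have gi : injective g.
  by move=> i j gij; apply: fi; rewrite ?inE // !fg gij.
exists (perm gi); apply/forallP => i; rewrite permE.
by have [|y] := fe i; rewrite ?inE // fg => -[->].
Qed.

(** Induction on the number of nonzero entries: subtracting [c] times a permutation matrix, with [c]
    the least entry on a positive diagonal, preserves nonnegativity and clears an entry. The line
    sums drop to [s - c], which is why [s] is arbitrary. *)
Lemma birkhoff {R : realType} {n : nat} (B : 'M[R]_n) (s : R) :
  (forall i j, 0 <= B i j) ->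
  (forall i, \sum_j B i j = s) -> (forall j, \sum_i B i j = s) ->
  exists2 lam : 'S_n -> R, (forall t, 0 <= lam t) &
    forall i j, B i j = \sum_t lam t * (t i == j)%:R.
Proof.
have [k] := ubnP #|[set p : 'I_n * 'I_n | B p.1 p.2 != 0]%SET|.
elim: k B s => // k IH B s /ltnSE Bk B0 Br Bc.
have [Bz|/forallPn[i0 /forallPn[j0 Bij0]]] :=
    boolP [forall i, [forall j, B i j == 0]].
  exists (fun=> 0) => // i j; rewrite big1; last by move=> *; rewrite mul0r.
  by apply/eqP; move: Bz => /forallP/(_ i)/forallP/(_ j).
have s0 : 0 < s.
  rewrite -(Br i0) (bigD1 j0) //= ltr_pwDl ?sumr_ge0 //.
  by rewrite lt_def Bij0 B0.
have [t /forallP tB] := const_sums_positive_diagonal B s s0 B0 Br Bc.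
pose i1 := [arg min_(i < i0) B i (t i)]%O.
have i1min i : B i1 (t i1) <= B i (t i).
  by rewrite /i1; case: arg_minP => // i2 _ /(_ i); apply.
set c := B i1 (t i1) in i1min; have c0 : 0 < c := tB i1.
pose B' : 'M[R]_n := \matrix_(i, j) (B i j - c * (t i == j)%:R).
have B'0 i j : 0 <= B' i j.
  rewrite mxE; case: eqP => [<-|_]; last by rewrite mulr0 subr0.
  by rewrite mulr1 subr_ge0.
have rowt i : \sum_j c * (t i == j)%:R = c.
  rewrite -mulr_sumr (bigD1 (t i)) //= eqxx big1 ?addr0 ?mulr1 // => j.
  by rewrite eq_sym => /negPf->.
have colt j : \sum_i c * (t i == j)%:R = c.
  rewrite -mulr_sumr (bigD1 (t^-1%g j)) //= permKV eqxx big1 ?addr0 ?mulr1 //.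
  move=> i; apply: contraNeq; rewrite pnatr_eq0 eqb0 negbK => /eqP<-.
  by rewrite permK.
have [|||lam lam0 lamE] := IH B' (s - c) _ B'0.
- apply: leq_trans Bk; apply: proper_card; apply/fintype.properP; split.
    apply/fintype.subsetP => -[i j]; rewrite !inE /= mxE; apply: contraNneq => Bij.
    have /eqP := B'0 i j; rewrite mxE Bij sub0r; case: (t i =P j) => [tij|].
      by have := tB i; rewrite tij Bij ltxx.
    by rewrite mulr0 oppr0.
  by exists (i1, t i1); rewrite !inE /= ?mxE ?eqxx ?mulr1 ?subrr ?eqxx // gt_eqF.
- move=> i; under eq_bigr do rewrite mxE.
  by rewrite sumrB Br rowt.
- move=> j; under eq_bigr do rewrite mxE.
  by rewrite sumrB Bc colt.
exists (fun u => lam u + c * (u == t)%:R) => [u|i j].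
  by rewrite addr_ge0 // mulr_ge0 // ltW.
under eq_bigr do rewrite mulrDl.
rewrite big_split /= -lamE mxE [X in _ + X](bigD1 t) //= eqxx mulr1.
rewrite big1 ?addr0 ?subrK // => u /negPf->.
by rewrite mulr0 mul0r.
Qed.

(** * Sum of squares of a doubly stochastic matrix *)

Lemma doubly_stochastic_sumsq_ge {R : realType} {n : nat} (B M : 'M[R]_n) :
  (0 < n)%N -> (forall i j, 0 <= B i j) -> (forall i j, 0 <= M i j) ->
  (forall i j, M i j = 0 -> B i j = 0) ->
  (forall i, \sum_j B i j = 1) -> (forall j, \sum_i B i j = 1) ->
  1 / #|positive_diagonals M|%:R <= n%:R^-1 * \sum_i \sum_j B i j * B i j.
Proof.
move=> n0 B0 M0 BM Br Bc.
have [lam lam0 lamE] := birkhoff B 1 B0 Br Bc.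
have lamB t i : lam t <= B i (t i).
  rewrite lamE (bigD1 t) //= eqxx mulr1 lerDl sumr_ge0 // => u _.
  by rewrite mulr_ge0.
have lamPD t : t \notin positive_diagonals M -> lam t = 0.
  rewrite inE => /forallPn[i]; rewrite -leNgt => Mi.
  apply/eqP; rewrite eq_le lam0 andbT (le_trans (lamB t i)) // BM //.
  by apply/eqP; rewrite eq_le Mi M0.
have dirac (k : 'I_n) (F : 'I_n -> R) : \sum_j (k == j)%:R * F j = F k.
  rewrite (bigD1 k) //= eqxx mul1r big1 ?addr0 // => j.
  by rewrite eq_sym => /negPf->; rewrite mul0r.
(* The total weight is read off the first row, which exists because [0 < n]. *)
have lam1 : \sum_t lam t = 1.
  rewrite -(Br (Ordinal n0)); under [RHS]eq_bigr do rewrite lamE.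
  rewrite exchange_big /=; apply: eq_bigr => t _.
  rewrite -mulr_sumr; under eq_bigr do rewrite -[_%:R]mulr1.
  by rewrite (dirac _ (fun=> 1)) mulr1.
(* Only one of the two factors is expanded; the other is then bounded below by [lamB]. *)
have BBE : \sum_i \sum_j B i j * B i j = \sum_t lam t * \sum_i B i (t i).
  under eq_bigr => i _ do under eq_bigr => j _ do rewrite {1}lamE mulr_suml.
  under eq_bigr => i _ do rewrite exchange_big /=.
  rewrite exchange_big; apply: eq_bigr => t _; rewrite mulr_sumr.
  apply: eq_bigr => i _; under eq_bigr do rewrite -mulrA.
  by rewrite -mulr_sumr dirac.
have lamsq : \sum_t lam t * lam t <= n%:R^-1 * \sum_i \sum_j B i j * B i j.
  rewrite BBE mulr_sumr; apply: ler_sum => t _.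
  rewrite mulrCA ler_wpM2l // mulrC ler_pdivlMr ?ltr0n //.
  rewrite mulr_natr -[X in _ *+ X](card_ord n) -sumr_const.
  by apply: ler_sum => i _.
apply: le_trans lamsq.
set PD := positive_diagonals M.
have restr (F : 'S_n -> R) : (forall t, t \notin PD -> F t = 0) ->
    \sum_t F t = \sum_(t in PD) F t.
  by move=> F0; rewrite (bigID (mem PD)) /= [X in _ + X]big1 ?addr0.
rewrite restr; last by move=> t /lamPD->; rewrite mul0r.
rewrite restr // in lam1; set d : R := #|PD|%:R.
have d0 : d != 0.
  rewrite pnatr_eq0; apply: contra_eq_neq lam1 => /eqP; rewrite cards_eq0.
  by move=> /eqP->; rewrite big_set0 eq_sym oner_neq0.
(* Cauchy-Schwarz as a variance: the mean of the [d] weights is 1 / d, so this sum of squared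
   deviations is the sum of squares minus 1 / d. *)
have : 0 <= \sum_(t in PD) (lam t - 1 / d) ^+ 2.
  by apply: sumr_ge0 => t _; apply: sqr_ge0.
have -> : \sum_(t in PD) (lam t - 1 / d) ^+ 2 =
    \sum_(t in PD) lam t * lam t - 1 / d.
  rewrite (eq_bigr (fun t => lam t * lam t - (2 / d * lam t - 1 / d ^+ 2))).
    rewrite sumrB sumrB -mulr_sumr lam1 sumr_const -mulr_natl -/d.
    by congr (_ - _); field.
  by move=> t _; field.
by rewrite subr_ge0.
Qed.

Local Open Scope classical_set_scope.

(** * Entropy inequalities *)

Lemma ln_le_subr1 {R : realType} (x : R) : 0 < x -> ln x <= x - 1.
Proof. by move=> x0; have := @le_ln1Dx R (x - 1); rewrite [1 + _]addrC subrK; apply; lra. Qed.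

(* With u = sqrt b and v = sqrt x, ln (v / u) <= v / u - 1 yields
   b (ln b - ln x) - b + x >= (u - v)^2. *)
Lemma sqrdist_le_kl {R : realType} (b x C : R) :
  0 <= b <= C -> 0 <= x <= C -> (b != 0 -> 0 < x) ->
  (b - x) ^+ 2 <= 4 * C * (b * (ln b - ln x) - b + x).
Proof.
move=> /andP[b0 bC] /andP[x0 xC] bx.
have [b_eq0|bn0] := eqVneq b 0; first by rewrite b_eq0 mul0r; nra.
have {}b0 : 0 < b by rewrite lt_def bn0.
have {}x0 := bx bn0.
have [u0 v0] : 0 < Num.sqrt b /\ 0 < Num.sqrt x by rewrite !sqrtr_gt0.
rewrite -(sqr_sqrtr (ltW b0)) -(sqr_sqrtr (ltW x0)) in bC xC *.
move: (Num.sqrt b) (Num.sqrt x) u0 v0 bC xC => u v u0 v0 uC vC.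
have lnuv : u * (ln v - ln u) <= v - u.
  have -> : v - u = u * (v / u - 1) by field; rewrite gt_eqF.
  by rewrite ler_pM2l // -ln_div ?posrE // ln_le_subr1 ?divr_gt0.
rewrite !lnXn // !mulr2n.
have kl : (u - v) ^+ 2 <=
    u ^+ 2 * (ln u + ln u - (ln v + ln v)) - u ^+ 2 + v ^+ 2.
  by have := ler_wpM2l (ltW u0) lnuv; lra.
have C0 : 0 <= C by apply: le_trans uC; apply: sqr_ge0.
apply: (@le_trans _ _ (4 * C * (u - v) ^+ 2)); last by rewrite ler_wpM2l // mulr_ge0.
(* The factor [4 * C] comes from (u + v)^2 <= 2 (u^2 + v^2) <= 4 C. *)
rewrite subr_sqr exprMn mulrC ler_wpM2r ?sqr_ge0 //.
by have := sqr_ge0 (u - v); lra.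
Qed.

(** This is [sqrdist_le_kl] with b = 1, x = c_j and C = n, summed over j; the linear terms cancel
    because the c_j average 1. *)
Lemma sum_sqr_sub1_le {R : realType} {n : nat} (c : 'I_n -> R) :
  (forall j, 0 < c j) -> \sum_j c j = n%:R ->
  \sum_j (c j - 1) ^+ 2 <= 4 * n%:R * - \sum_j ln (c j).
Proof.
move=> c0 cn.
have -> : - \sum_j ln (c j) = \sum_j (1 * (ln 1 - ln (c j)) - 1 + c j).
  rewrite !big_split /= -mulr_sumr sumrB /= cn ln1 !sumr_const card_ord mul0rn.
  by rewrite mulNrn; lra.
rewrite mulr_sumr; apply: ler_sum => j _.
rewrite -opprB sqrrN; apply: sqrdist_le_kl => //.
  by rewrite ler01 ler1n (leq_ltn_trans _ (ltn_ord j)).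
rewrite ltW //= -cn (bigD1 j) //= lerDl sumr_ge0 // => i _; exact: ltW.
Qed.

Lemma sum_ln_le0 {R : realType} {n : nat} (c : 'I_n -> R) :
  (forall j, 0 < c j) -> \sum_j c j = n%:R -> \sum_j ln (c j) <= 0.
Proof.
move=> c0 cn; apply: (@le_trans _ _ (\sum_j (c j - 1))).
  by apply: ler_sum => j _; apply: ln_le_subr1.
by rewrite sumrB cn sumr_const card_ord subrr.
Qed.

(** * Limits and compactness for matrices *)

Lemma cvg_mx {R : realType} {m n : nat} (X : nat -> 'M[R]_(m, n))
    (B : 'M[R]_(m, n)) :
  (forall i j, X k i j @[k --> \oo] --> B i j) -> X k @[k --> \oo] --> B.
Proof.
move=> XB; apply/cvg_ballP => e e0.
have : \forall k \near \oo, forall p : 'I_m * 'I_n, ball (B p.1 p.2) e (X k p.1 p.2).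
  by apply: filter_forall => p; move/cvg_ballP: (XB p.1 p.2); apply.
by apply: filterS => k Xk; split=> // i j; apply: (Xk (i, j)).
Qed.

Lemma cvg_sumr {R : realType} {n : nat} (f : nat -> 'I_n -> R) (l : 'I_n -> R) :
  (forall i, f k i @[k --> \oo] --> l i) ->
  \sum_i f k i @[k --> \oo] --> \sum_i l i.
Proof.
move=> fl; apply: (@cvg_big _ _ _ _ xpredT (@add_continuous _)) => i _.
exact: fl.
Qed.

Lemma cvg_geq_id (f : nat -> nat) : (forall k, (k <= f k)%N) ->
  f k @[k --> \oo] --> \oo.
Proof.
move=> fk A [N _ NA]; exists N => // k /= Nk; apply: NA => /=.
exact: leq_trans Nk (fk k).
Qed.

(** The flattened matrices lie in a compact cube and so have a cluster point; [f k] picks a later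
    index within 1 / (k + 1) of it. The bound [k <= f k] makes [f] tend to infinity. *)
Lemma bounded_mx_subseq {R : realType} {m n : nat} (X : nat -> 'M[R]_(m, n)) :
  (forall k i j, 0 <= X k i j <= 1) ->
  exists f : nat -> nat, (forall k, (k <= f k)%N) /\
    exists B : 'M[R]_(m, n), forall i j, X (f k) i j @[k --> \oo] --> B i j.
Proof.
move=> X01.
have K := @rV_compact R (m * n) (fun=> `[0, 1]%classic)
  (fun=> @segment_compact _ _ _).
have [|v [_ vcl]] := K (mxvec (X k) @[k --> \oo]) _.
  exists 0%N => // k _ p /=; case/mxvec_indexP: p => i j.
  by rewrite mxvecE /= in_itv /= X01.
have step k : exists k', (k <= k')%N /\
    forall i j, `|vec_mx v i j - X k' i j| < k.+1%:R^-1.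
  have e0 : 0 < k.+1%:R^-1 :> R by rewrite invr_gt0.
  have [] := vcl [set w | exists2 k', (k <= k')%N & w = mxvec (X k')]
    (ball v k.+1%:R^-1) _ (nbhsx_ballx _ _ e0).
    by exists k => // k' /= kk'; exists k'.
  move=> _ [[k' kk' ->] [_ vX]]; exists k'; split=> // i j.
  by have := vX ord0 (mxvec_index i j); rewrite mxvecE mxE.
have [f fP] := choice step.
exists f; split=> [k|]; first by have [] := fP k.
exists (vec_mx v) => i j; apply/cvgrPdist_lt => e e0.
have := near_infty_natSinv_lt (PosNum e0).
by apply: filterS => k /= ke; apply: lt_trans ke; have [_] := fP k; apply.
Qed.

(** * Supports, normalizations and log-likelihood *)

(** Invariant of the iteration: it makes all line sums positive, so no normalization divides by
    zero. *)
Definition nonneg_no_zero_line {R : realType} {n : nat} (X : 'M[R]_n) : Prop :=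
  [/\ forall i j, 0 <= X i j, forall i, exists j, X i j != 0
    & forall j, exists i, X i j != 0].

(** Nonnegativity of [Y] is included so that [nonneg_no_zero_line] passes from [X] to [Y]. *)
Definition same_support {R : realType} {n : nat} (X Y : 'M[R]_n) : Prop :=
  forall i j, 0 <= Y i j /\ (Y i j == 0) = (X i j == 0).

Definition doubly_stochastic {R : realType} {n : nat} (B : 'M[R]_n) : Prop :=
  [/\ forall i j, 0 <= B i j, forall i, \sum_j B i j = 1
    & forall j, \sum_i B i j = 1].

Definition support_in {R : realType} {n : nat} (B X : 'M[R]_n) : Prop :=
  forall i j, X i j = 0 -> B i j = 0.

(* Up to a term depending only on B, this is the opposite of the Kullback-Leibler
   divergence KL(B || X), provided support_in B X: the junk value ln 0 = 0 stands
   where the divergence would be infinite. *)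
Definition loglik {R : realType} {n : nat} (B X : 'M[R]_n) : R :=
  \sum_i \sum_j B i j * ln (X i j).

Lemma sum_gt0 {R : realType} {n : nat} (f : 'I_n -> R) :
  (forall i, 0 <= f i) -> (exists i, f i != 0) -> 0 < \sum_i f i.
Proof.
move=> f0 [i fi]; rewrite (bigD1 i) //= ltr_pwDl ?sumr_ge0 //.
by rewrite lt_def fi f0.
Qed.

(** Through transposition, facts on column normalization follow from those on rows. *)
Lemma col_normalizeE {R : realType} {n : nat} (X : 'M[R]_n) :
  col_normalize X = (row_normalize X^T)^T.
Proof.
apply/matrixP => i j; rewrite !mxE; congr (_ / _).
by apply: eq_bigr => l _; rewrite mxE.
Qed.

Lemma nonneg_no_zero_line_tr {R : realType} {n : nat} (X : 'M[R]_n) :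
  nonneg_no_zero_line X -> nonneg_no_zero_line X^T.
Proof.
move=> [X0 Xr Xc]; split=> [i j|i|j]; first by rewrite mxE.
  by have [j Xij] := Xc i; exists j; rewrite mxE.
by have [i Xij] := Xr j; exists i; rewrite mxE.
Qed.

Lemma nonneg_no_zero_line_support {R : realType} {n : nat} (X Y : 'M[R]_n) :
  nonneg_no_zero_line X -> same_support X Y -> nonneg_no_zero_line Y.
Proof.
move=> [X0 Xr Xc] XY; split=> [i j|i|j]; first by have [] := XY i j.
  by have [j Xij] := Xr i; exists j; have [_ ->] := XY i j.
by have [i Xij] := Xc j; exists i; have [_ ->] := XY i j.
Qed.

Lemma same_support_trans {R : realType} {n : nat} (X Y Z : 'M[R]_n) :
  same_support X Y -> same_support Y Z -> same_support X Z.
Proof.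
by move=> XY YZ i j; have [_ <-] := XY i j; have [? <-] := YZ i j.
Qed.

Lemma support_in_same {R : realType} {n : nat} (B X Y : 'M[R]_n) :
  same_support X Y -> support_in B X -> support_in B Y.
Proof.
move=> XY BX i j /eqP; have [_ ->] := XY i j.
by move=> /eqP/BX.
Qed.

Lemma row_normalize_support {R : realType} {n : nat} (X : 'M[R]_n) :
  nonneg_no_zero_line X -> same_support X (row_normalize X).
Proof.
move=> [X0 Xr _] i j; have s0 := sum_gt0 _ (X0 i) (Xr i).
by rewrite mxE divr_ge0 ?(ltW s0) // mulf_eq0 invr_eq0 (gt_eqF s0) orbF.
Qed.

Lemma col_normalize_support {R : realType} {n : nat} (X : 'M[R]_n) :
  nonneg_no_zero_line X -> same_support X (col_normalize X).
Proof.
move=> /nonneg_no_zero_line_tr/row_normalize_support Xs i j.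
by have := Xs j i; rewrite col_normalizeE !mxE.
Qed.

Lemma row_normalize_sum {R : realType} {n : nat} (X : 'M[R]_n) :
  nonneg_no_zero_line X -> forall i, \sum_j row_normalize X i j = 1.
Proof.
move=> [X0 Xr _] i; under eq_bigr do rewrite mxE.
by rewrite -mulr_suml divff // gt_eqF // sum_gt0.
Qed.

Lemma col_normalize_sum {R : realType} {n : nat} (X : 'M[R]_n) :
  nonneg_no_zero_line X -> forall j, \sum_i col_normalize X i j = 1.
Proof.
move=> /nonneg_no_zero_line_tr/row_normalize_sum Xs j.
by rewrite -(Xs j) col_normalizeE; apply: eq_bigr => i _; rewrite [in LHS]mxE.
Qed.

Lemma loglik_tr {R : realType} {n : nat} (B X : 'M[R]_n) :
  loglik B^T X^T = loglik B X.
Proof.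
rewrite /loglik exchange_big; apply: eq_bigr => i _; apply: eq_bigr => j _.
by rewrite !mxE.
Qed.

(** The logarithm of each row sum is collected with total weight 1, a row sum of [B]. Where [X]
    vanishes so does [B], which neutralizes the value of ln 0. *)
Lemma loglik_row_normalize {R : realType} {n : nat} (B X : 'M[R]_n) :
  nonneg_no_zero_line X -> support_in B X -> (forall i, \sum_j B i j = 1) ->
  loglik B (row_normalize X) = loglik B X - \sum_i ln (\sum_j X i j).
Proof.
move=> [X0 Xr _] BX Br; rewrite -sumrB; apply: eq_bigr => i _.
rewrite -[X in _ - X]mul1r -(Br i) mulr_suml -sumrB; apply: eq_bigr => j _.
have [/BX->|Xij] := eqVneq (X i j) 0; first by rewrite !mul0r subrr.
by rewrite -mulrBr mxE ln_div ?posrE ?sum_gt0 // lt_def Xij X0.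
Qed.

Lemma loglik_col_normalize {R : realType} {n : nat} (B X : 'M[R]_n) :
  nonneg_no_zero_line X -> support_in B X -> (forall j, \sum_i B i j = 1) ->
  loglik B (col_normalize X) = loglik B X - \sum_j ln (\sum_i X i j).
Proof.
move=> Xp BX Bc; rewrite col_normalizeE -loglik_tr trmxK.
rewrite loglik_row_normalize ?loglik_tr.
- by congr (_ - _); apply: eq_bigr => j _; congr ln; apply: eq_bigr => i _; rewrite mxE.
- exact: nonneg_no_zero_line_tr.
- by move=> i j; rewrite !mxE => /BX.
- by move=> j; rewrite -(Bc j); apply: eq_bigr => i _; rewrite mxE.
Qed.

(** * Invariants of the Sinkhorn iterates *)

Lemma SK_L_support {R : realType} {n : nat} (M : 'M[R]_n) k :
  nonneg_no_zero_line M -> same_support M (SK_L M k).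
Proof.
move=> Mp; elim: k => [|k IH] /=; first exact: row_normalize_support.
have Lp := nonneg_no_zero_line_support _ _ Mp IH.
have LT := col_normalize_support _ Lp.
have Tp := nonneg_no_zero_line_support _ _ Lp LT.
apply: same_support_trans IH (same_support_trans _ _ _ LT _).
exact: row_normalize_support.
Qed.

Lemma SK_L_nonneg_no_zero_line {R : realType} {n : nat} (M : 'M[R]_n) k :
  nonneg_no_zero_line M -> nonneg_no_zero_line (SK_L M k).
Proof.
by move=> Mp; exact: (nonneg_no_zero_line_support _ _ Mp (SK_L_support _ k Mp)).
Qed.

Lemma SK_T_nonneg_no_zero_line {R : realType} {n : nat} (M : 'M[R]_n) k :
  nonneg_no_zero_line M -> nonneg_no_zero_line (SK_T M k).
Proof.
move=> /(SK_L_nonneg_no_zero_line _ k) Lp.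
exact: (nonneg_no_zero_line_support _ _ Lp (col_normalize_support _ Lp)).
Qed.

Lemma SK_L_row_sum {R : realType} {n : nat} (M : 'M[R]_n) k :
  nonneg_no_zero_line M -> forall i, \sum_j SK_L M k i j = 1.
Proof.
move=> Mp; case: k => [|k] /=; apply: row_normalize_sum => //.
exact: SK_T_nonneg_no_zero_line.
Qed.

Lemma SK_L_le1 {R : realType} {n : nat} (M : 'M[R]_n) k :
  nonneg_no_zero_line M -> forall i j, 0 <= SK_L M k i j <= 1.
Proof.
move=> Mp i j; have [L0 _ _] := SK_L_nonneg_no_zero_line _ k Mp.
by rewrite L0 -(SK_L_row_sum _ k Mp i) (bigD1 j) //= lerDl sumr_ge0.
Qed.

Lemma SK_L_col_sum_gt0 {R : realType} {n : nat} (M : 'M[R]_n) k :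
  nonneg_no_zero_line M -> forall j, 0 < \sum_i SK_L M k i j.
Proof.
by move=> /(SK_L_nonneg_no_zero_line _ k) [L0 _ Lc] j; apply: sum_gt0.
Qed.

Lemma SK_L_total {R : realType} {n : nat} (M : 'M[R]_n) k :
  nonneg_no_zero_line M -> \sum_j \sum_i SK_L M k i j = n%:R.
Proof.
move=> Mp; rewrite exchange_big (eq_bigr (fun=> 1)) => [|i _].
  by rewrite sumr_const card_ord.
exact: SK_L_row_sum.
Qed.

(** * Monotonicity of the log-likelihood along the iteration *)

(** The column step gains exactly the subtracted sum; the row step after it gains a nonnegative
    amount, since the row sums of [SK_T M k] average 1. *)
Lemma loglik_SK_step {R : realType} {n : nat} (M B : 'M[R]_n) k :
  nonneg_no_zero_line M -> doubly_stochastic B -> support_in B M ->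
  loglik B (SK_L M k) - \sum_j ln (\sum_i SK_L M k i j) <=
  loglik B (SK_L M k.+1).
Proof.
move=> Mp [_ Br Bc] BM.
have Lp := SK_L_nonneg_no_zero_line _ k Mp.
have Tp := SK_T_nonneg_no_zero_line _ k Mp.
have BL := support_in_same _ _ _ (SK_L_support _ k Mp) BM.
have BT := support_in_same _ _ _ (col_normalize_support _ Lp) BL.
rewrite /= [leRHS]loglik_row_normalize // loglik_col_normalize //.
rewrite lerDl oppr_ge0 sum_ln_le0 // => [i|].
  by have [T0 Tr _] := Tp; apply: sum_gt0.
rewrite exchange_big (eq_bigr (fun=> 1)) => [|j _].
  by rewrite sumr_const card_ord.
exact: col_normalize_sum.
Qed.

Lemma loglik_SK_ndecr {R : realType} {n : nat} (M B : 'M[R]_n) :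
  nonneg_no_zero_line M -> doubly_stochastic B -> support_in B M ->
  {homo (fun k => loglik B (SK_L M k)) : k l / (k <= l)%N >-> k <= l}.
Proof.
move=> Mp Bd BM; apply/nondecreasing_seqP => k.
apply: le_trans (loglik_SK_step _ _ k Mp Bd BM).
by rewrite lerDl oppr_ge0 sum_ln_le0 ?SK_L_total // => j; apply: SK_L_col_sum_gt0.
Qed.

Lemma loglik_SK_cvg {R : realType} {n : nat} (M B : 'M[R]_n) :
  nonneg_no_zero_line M -> doubly_stochastic B -> support_in B M ->
  cvgn (fun k => loglik B (SK_L M k)).
Proof.
move=> Mp Bd BM; apply: nondecreasing_is_cvgn; first exact: loglik_SK_ndecr.
exists 0 => _ [k _ <-]; have [B0 _ _] := Bd.
apply: sumr_le0 => i _; apply: sumr_le0 => j _.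
by rewrite mulr_ge0_le0 // ln_le0 //; have /andP[] := SK_L_le1 _ k Mp i j.
Qed.

(** The increments of the convergent log-likelihood tend to 0 and, times 4n, dominate the squared
    deviations of the column sums from 1. *)
Lemma SK_L_col_sum_cvg {R : realType} {n : nat} (M B : 'M[R]_n) :
  nonneg_no_zero_line M -> doubly_stochastic B -> support_in B M ->
  forall j, \sum_i SK_L M k i j @[k --> \oo] --> (1 : R).
Proof.
move=> Mp Bd BM j; have uc := loglik_SK_cvg _ _ Mp Bd BM.
set u := fun k => loglik B (SK_L M k) in uc.
have du : u k.+1 - u k @[k --> \oo] --> 0.
  rewrite -(subrr (limn u)); apply: cvgB (uc).
  by have := uc; rewrite -(cvg_shiftS u).
have {}du : 4 * n%:R * (u k.+1 - u k) @[k --> \oo] --> 0.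
  by rewrite -(mulr0 (4 * n%:R)); apply: cvgMr.
apply/cvgrPdist_lt => e e0.
have /cvgr0Pnorm_lt/(_ (e ^+ 2) (exprn_gt0 _ e0)) := du.
apply: filterS => k /(le_lt_trans (ler_norm _)) due.
rewrite -(ltr_pXn2r (n := 2)) ?nnegrE ?normr_ge0 ?ltW // real_normK ?num_real //.
apply: le_lt_trans due; rewrite -opprB sqrrN.
apply: (@le_trans _ _ (\sum_j (\sum_i SK_L M k i j - 1) ^+ 2)).
  by rewrite [leRHS](bigD1 j) //= lerDl sumr_ge0 // => i _; apply: sqr_ge0.
apply: le_trans (sum_sqr_sub1_le _ (SK_L_col_sum_gt0 _ k Mp) (SK_L_total _ k Mp)) _.
rewrite ler_wpM2l ?mulr_ge0 // lerBrDl.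
exact: loglik_SK_step.
Qed.

(** * Convergence to a doubly stochastic limit *)

(** A Pinsker-type bound: [sqrdist_le_kl] with C = 1 is summed over all entries, and the linear
    terms cancel because both matrices have row sums 1. *)
Lemma sqrdist_le_loglik {R : realType} {n : nat} (B X : 'M[R]_n) i j :
  doubly_stochastic B -> support_in B X ->
  (forall i j, 0 <= X i j <= 1) -> (forall i, \sum_j X i j = 1) ->
  (B i j - X i j) ^+ 2 <= 4 * (loglik B B - loglik B X).
Proof.
move=> [B0 Br Bc] BX X01 Xr.
have B01 k l : 0 <= B k l <= 1.
  by rewrite B0 -(Br k) (bigD1 l) //= lerDl sumr_ge0.
have kl k l : (B k l - X k l) ^+ 2 <=
    4 * (B k l * (ln (B k l) - ln (X k l)) - B k l + X k l).
  rewrite -[4]mulr1; apply: sqrdist_le_kl => // Bkl.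
  have /andP[X0 _] := X01 k l; rewrite lt_def X0 andbT.
  by apply: contraNneq Bkl => /BX->.
apply: (@le_trans _ _ (\sum_k \sum_l (B k l - X k l) ^+ 2)).
  rewrite (bigD1 i) //= (bigD1 j) //= -addrA lerDl addr_ge0 // ?sumr_ge0 //.
    by move=> *; apply: sqr_ge0.
  by move=> *; apply: sumr_ge0 => *; apply: sqr_ge0.
rewrite /loglik -sumrB mulr_sumr; apply: ler_sum => k _.
apply: (@le_trans _ _ (\sum_l 4 * (B k l * (ln (B k l) - ln (X k l)) - B k l + X k l))).
  by apply: ler_sum => l _; apply: kl.
rewrite -mulr_sumr big_split sumrB /= Br Xr subrK ler_wpM2l // -sumrB.
by apply: ler_sum => l _; rewrite mulrBr.
Qed.

(** Discontinuity of ln at 0 does no harm: entries with [B i j = 0] contribute the constant 0, and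
    elsewhere the limit is positive. *)
Lemma loglik_cvg {R : realType} {n : nat} (X : nat -> 'M[R]_n) (B : 'M[R]_n) :
  (forall i j, 0 <= B i j) -> (forall i j, X k i j @[k --> \oo] --> B i j) ->
  loglik B (X k) @[k --> \oo] --> loglik B B.
Proof.
move=> B0 XB; apply: cvg_sumr => i; apply: cvg_sumr => j.
have [->|Bij] := eqVneq (B i j) 0.
  by under eq_fun do rewrite mul0r; rewrite mul0r; apply: cvg_cst.
apply: cvgMr; apply: continuous_cvg (XB i j).
by apply: continuous_ln; rewrite lt_def Bij B0.
Qed.

Lemma perm_mx_doubly_stochastic {R : realType} {n : nat} (t : 'S_n) :
  doubly_stochastic (perm_mx t : 'M[R]_n).
Proof.
split=> [i j|i|j]; first by rewrite !mxE.
- rewrite (bigD1 (t i)) //= !mxE eqxx big1 ?addr0 // => j.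
  by rewrite !mxE eq_sym => /negPf->.
- rewrite (bigD1 (t^-1%g j)) //= !mxE permKV eqxx big1 ?addr0 // => i.
  rewrite !mxE; apply: contraNeq; rewrite pnatr_eq0 eqb0 negbK => /eqP<-.
  by rewrite permK.
Qed.

Lemma sinkhorn_knopp {R : realType} {n : nat} (M : 'M[R]_n) (t : 'S_n) :
  nonneg_no_zero_line M -> positive_diagonal M t ->
  exists B, [/\ doubly_stochastic B, support_in B M,
    SK_L M k @[k --> \oo] --> B & SK_T M k @[k --> \oo] --> B].
Proof.
move=> Mp /forallP tM.
have PM : support_in (perm_mx t) M.
  move=> i j Mij; rewrite !mxE; case: eqP => // tij.
  by have := tM i; rewrite tij Mij ltxx.
have cc := SK_L_col_sum_cvg _ _ Mp (perm_mx_doubly_stochastic t) PM.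
have [f [fge [B fB]]] := bounded_mx_subseq _ (fun k => SK_L_le1 M k Mp).
have f_oo := cvg_geq_id _ fge.
have B0 i j : 0 <= B i j.
  apply: (closed_cvg (fun x : R => 0 <= x) _ _ _ (fB i j)); first exact: closed_ge.
  by apply: nearW => k; have /andP[] := SK_L_le1 M (f k) Mp i j.
have Br i : \sum_j B i j = 1.
  apply: (@cvg_unique _ (@norm_hausdorff _ R) _ _ _ _ (cvg_sumr _ _ (fB i))).
  by apply: cvg_near_cst; apply: nearW => k; exact: SK_L_row_sum.
have Bc j : \sum_i B i j = 1.
  apply: (@cvg_unique _ (@norm_hausdorff _ R) _ _ _ _
           (cvg_sumr _ _ (fun i => fB i j))).
  exact: (cvg_comp _ _ f_oo (cc j)).
have BM : support_in B M.
  move=> i j /eqP Mij.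
  apply: (@cvg_unique _ (@norm_hausdorff _ R) _ _ _ _ (fB i j)).
  apply: cvg_near_cst; apply: nearW => k.
  by apply/eqP; have [_ ->] := SK_L_support _ (f k) Mp i j.
have Bd : doubly_stochastic B by split.
(* The bounded monotone sequence of the loglik B (SK_L M k) has the same limit
   as its subsequence, so the divergence of SK_L M k from B tends to 0. *)
have uB : loglik B (SK_L M k) @[k --> \oo] --> loglik B B.
  have uc := loglik_SK_cvg _ _ Mp Bd BM.
  suff -> : loglik B B = limn (fun k => loglik B (SK_L M k)) by [].
  apply: (@cvg_unique _ (@norm_hausdorff _ R) _ _ _ _ (loglik_cvg _ _ B0 fB)).
  exact: (cvg_comp _ _ f_oo uc).
have LB i j : SK_L M k i j @[k --> \oo] --> B i j.
  have : 4 * (loglik B B - loglik B (SK_L M k)) @[k --> \oo] --> 0.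
    rewrite -(mulr0 4) -(subrr (loglik B B)); apply: cvgMr.
    by apply: cvgB uB; apply: cvg_cst.
  move=> du; apply/cvgrPdist_lt => e e0.
  have /cvgr0Pnorm_lt/(_ (e ^+ 2) (exprn_gt0 _ e0)) := du.
  apply: filterS => k /(le_lt_trans (ler_norm _)) due.
  rewrite -(ltr_pXn2r (n := 2)) ?nnegrE ?normr_ge0 ?ltW // real_normK ?num_real //.
  apply: le_lt_trans due; apply: sqrdist_le_loglik => //.
  - exact: (support_in_same _ _ _ (SK_L_support _ k Mp) BM).
  - exact: SK_L_le1.
  - exact: SK_L_row_sum.
exists B; split=> //; first exact: cvg_mx.
(* [SK_T] divides each entry of [SK_L] by a column sum tending to 1, by [cc]. *)
apply: cvg_mx => i j; under eq_fun do rewrite mxE.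
rewrite -[B i j]mulr1 -[1]invr1; apply: cvgM => //.
by apply: cvgV => //; exact: oner_neq0.
Qed.

(** * Lower bound for the cooperative index *)

Theorem proposition28 (R : realType) (n : nat) (hn : (0 < n)%N)
    (M : 'M[R]_n) (d : nat)
    (M_ge0 : forall i j, 0 <= M i j)
    (M_row : forall i, exists j, M i j != 0)
    (M_col : forall j, exists i, M i j != 0)
    (hd : (1 <= d)%N)
    (M_diag : #|positive_diagonals M| = d) :
  1 / d%:R <= CI M.
Proof.
have [t] : exists t, t \in positive_diagonals M.
  by apply/set0Pn; rewrite -card_gt0 M_diag.
rewrite inE => tM.
have [||B [[B0 Br Bc] BM LB TB]] := sinkhorn_knopp M t; [by split|by []|].
have haus := @norm_hausdorff R 'M[R]_n.
rewrite /CI /SK_limL /SK_limT (cvg_lim haus LB) (cvg_lim haus TB) -M_diag.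
exact: doubly_stochastic_sumsq_ge.
Qed.
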